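(* Let $k\geq 1$ and $n\geq 3$ be integers. There exist a standard Borel space $Y$ with a Borel probability measure $\mu$ and Borel graphs $\mathcal{G}_j$ ($j<k$) on $Y$ with pairwise disjoint edge sets such that (1) $\bigcup_{j<k}\mathcal{G}_j$ is acyclic and has bounded degree; (2) for every $j<k$, if $B,B'\subseteq Y$ are measurable with $\mu(B)\geq\frac1n$ and $\mu(B')\geq\frac1n$, then there exist $z\in B$ and $z'\in B'$ that are adjacent in $\mathcal{G}_j$.
   Context: A Borel graph on $Y$ is a graph whose edge set is Borel in $Y^2$. Acyclic means containing no cycles; bounded degree means there is a uniform finite bound on vertex degrees. *)

(* Defs.v *)
From HB Require Import structures.
From mathcomp Require Import all_boot all_order all_algebra.
From mathcomp Require Import all_classical all_reals all_analysis.
Set Implicit Arguments.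
Unset Strict Implicit.
Unset Printing Implicit Defensive.
Import Order.TTheory GRing.Theory Num.Theory.
Local Open Scope classical_set_scope.

Definition complete_metric (R : realType) (T : metricType R) : Prop :=
  forall F : set_system T, ProperFilter F -> cauchy F -> exists x : T, F --> x.

Definition separable (T : topologicalType) : Prop :=
  exists2 D : set T, countable D & dense D.

(* Y is isomorphic, as a measurable space, to a Polish space with its Borel
   sigma-algebra; as f is bijective, the last clause says that both f and its
   inverse are measurable. *)
Definition standard_borel (R : realType) (d : measure_display)
    (Y : measurableType d) : Prop :=
  exists (T : metricType R) (f : Y -> T),
    [/\ complete_metric T, separable T, bijective f &
        forall A : set T, <<s @open T >> A <-> measurable (f @^-1` A)].

(* A simple graph on Y is its adjacency relation: a symmetric irreflexive
   subset of Y * Y. *)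
Definition simple_graph (Y : Type) (G : set (Y * Y)) : Prop :=
  (forall x, ~ G (x, x)) /\ (forall x y, G (x, y) -> G (y, x)).

Definition borel_graph (d : measure_display) (Y : measurableType d)
    (G : set (Y * Y)) : Prop :=
  simple_graph G /\ measurable G.

(* The length is at least 3 because traversing one edge back and forth, which
   [ucycle] accepts, is not a cycle. *)
Definition acyclic (Y : choiceType) (G : set (Y * Y)) : Prop :=
  forall c : seq Y, (3 <= size c)%N -> ~ ucycle [rel x y | (x, y) \in G] c.

Definition bounded_degree (Y : Type) (G : set (Y * Y)) : Prop :=
  exists D : nat, forall x, ([set y | G (x, y)] #<= `I_D)%card.

(* Main.v *)
Require Import Defs.
From HB Require Import structures.
From mathcomp Require Import all_boot all_order all_algebra finmap.
From mathcomp Require Import all_classical all_reals all_analysis.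
From mathcomp Require Import ring lra zify.
Set Implicit Arguments.
Unset Strict Implicit.
Unset Printing Implicit Defensive.
Import Order.TTheory GRing.Theory Num.Theory.
Local Open Scope classical_set_scope.
Local Open Scope ring_scope.

(**
Let [S] be the set of pairs [(j, a)] with [j < k] and [a < m], let [Gamma] be
the free product of copies of Z/2 indexed by [S], and let [Gamma] act by shifts
on the cube [{0,1}^Gamma] with the fair coin measure.  The graph [G_j] joins
[x] to [(j, a) x] whenever both points lie in the free part, i.e. are fixed by
no nontrivial reduced word; the union of the [G_j] is then acyclic of degree at
most [#|S|], and the free part is conull.

Expansion is a spectral gap.  In the Walsh basis, indexed by the finite subsets
[u] of [Gamma], a generator [s] acts by [u |-> s u].  Call [s] dominant for [u]
if at least half of the elements of [u] are reduced words starting with [s].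
Since [s] exchanges the words starting with [s] and the others, [s] is dominant
for [u] or for [s u], while at most two generators are dominant for a given
nonempty [u].  A weighted AM-GM then bounds the sum of the nontrivial Fourier
terms of [mu (C `&` s^-1 D)] over [m] generators by [r m + 2 / r] for every
[r > 0], so for [m = 32 n^4] two sets of measure at least [1 / n] cannot avoid
each other.
*)

(** * The Cantor cube *)

Section countable_quantifiers.
Context {d : measure_display} {T : measurableType d} {U : countType}.

Lemma measurable_existsT (P : U -> set T) :
  (forall u, measurable (P u)) -> measurable [set x | exists u, P u x].
Proof.
move=> mP; rewrite (_ : mkset _ = \bigcup_u P u).
  by apply: countable_bigcupT_measurable => //; exact: countableP.
by apply/seteqP; split=> x [u]; [exists u | move=> _; exists u].
Qed.

Lemma measurable_forallT (P : U -> set T) :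
  (forall u, measurable (P u)) -> measurable [set x | forall u, P u x].
Proof.
move=> mP; rewrite (_ : mkset _ = ~` [set x | exists u, (~` P u) x]).
  by apply: measurableC; apply: measurable_existsT => u; exact: measurableC.
apply/seteqP; split=> x /= => [h [u]|h u]; first exact.
by apply: contrapT => Pu; apply: h; exists u.
Qed.

End countable_quantifiers.

(* [R] is a phantom parameter: it selects the field in which distances are measured. *)
Definition cube (R : realType) (I : countType) := I -> bool.

Section cube_metric.
Context {R : realType} {I : countType}.
Local Notation X := (cube R I).

HB.instance Definition _ := gen_eqMixin X.
HB.instance Definition _ := gen_choiceMixin X.
HB.instance Definition _ := isPointed.Build X (fun=> false).

(** Coordinates are ordered by their codes. The sets [agree N x] are the cylinders around [x], which
    serve as basic neighbourhoods. *)
Definition agree (N : nat) (x y : X) := forall i, (choice.pickle i < N)%N -> x i = y i.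

Lemma agree_sym N x y : agree N x y -> agree N y x.
Proof. by move=> xy i iN; rewrite xy. Qed.

Lemma agree_trans N x y z : agree N x y -> agree N y z -> agree N x z.
Proof. by move=> xy yz i iN; rewrite xy// yz. Qed.

Lemma agree_le M N x y : (M <= N)%N -> agree N x y -> agree M x y.
Proof. by move=> MN xy i iM; apply: xy; apply: leq_trans MN. Qed.

Lemma neq_agreeN x y : x <> y -> exists n, `[< ~ agree n.+1 x y >].
Proof.
move=> xy; have [i xyi] : exists i, x i <> y i.
  by apply/existsNP => h; apply: xy; apply/funext.
by exists (choice.pickle i); apply/asboolP => /(_ i (ltnSn _)).
Qed.

(** The exponent is the code of the first coordinate where [x] and [y] differ, whence the shift from
    [N] to [N.+1] in the description of balls by [agree]. *)
Definition cube_dist (x y : X) : R :=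
  if pselect (x = y) is right xy then 2^-1 ^+ ex_minn (neq_agreeN xy) else 0.

Lemma cube_dist_lt N x y : cube_dist x y < 2^-1 ^+ N <-> agree N.+1 x y.
Proof.
rewrite /cube_dist; case: pselect => [->|xy].
  by split=> // _; rewrite exprn_gt0// invr_gt0.
case: ex_minnP => m /asboolP mxy mmin.
rewrite ltr_iXn2l ?invr_gt0// ?invf_lt1// ?ltr1n//.
split=> [Nm|Nxy].
  by apply: contrapT => Nxy; have := mmin N; rewrite leqNgt Nm => /(_ _)/negP; apply=> //; apply/asboolP.
by rewrite ltnNge; apply/negP => mN; apply: mxy; apply: agree_le Nxy.
Qed.

Lemma cube_dist_le N x y : ~ agree N.+1 x y -> 2^-1 ^+ N <= cube_dist x y.
Proof. by move=> /cube_dist_lt/negP; rewrite -leNgt. Qed.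

Let distxx x : cube_dist x x = 0.
Proof. by rewrite /cube_dist; case: pselect. Qed.

Let dist_positivity x y : cube_dist x y = 0 -> x = y.
Proof.
by rewrite /cube_dist; case: pselect => // xy /eqP; rewrite expf_eq0 invr_eq0 pnatr_eq0 andbF.
Qed.

Let dist_ge0 x y : 0 <= cube_dist x y.
Proof. by rewrite /cube_dist; case: pselect => // xy; rewrite exprn_ge0// invr_ge0. Qed.

Let dist_sym x y : cube_dist x y = cube_dist y x.
Proof.
have le x' y' : cube_dist x' y' <= cube_dist y' x'.
  rewrite {1}/cube_dist; case: pselect => // xy.
  case: ex_minnP => m /asboolP mxy _; apply: cube_dist_le.
  by move=> /agree_sym.
by apply/eqP; rewrite eq_le !le.
Qed.

(** The ultrametric argument: if [x] and [z] differ at code [m], then [y] differs from one of them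
    at a code at most [m]. *)
Let dist_triangle y x z : cube_dist x z <= cube_dist x y + cube_dist y z.
Proof.
rewrite {1}/cube_dist; case: pselect => [_|xz]; first by rewrite addr_ge0.
case: ex_minnP => m /asboolP mxz _.
have [xy|/cube_dist_le xy] := pselect (agree m.+1 x y); last by rewrite ler_wpDr.
have [yz|/cube_dist_le yz] := pselect (agree m.+1 y z); last by rewrite ler_wpDl.
by exfalso; apply: mxz; apply: agree_trans yz.
Qed.

HB.instance Definition _ :=
  isMetric.Build R X distxx dist_positivity dist_sym dist_triangle.

Lemma cube_ballE x N : ball x (2^-1 ^+ N) = [set y : X | agree N.+1 x y].
Proof.
by rewrite ballEmdist; apply/seteqP; split=> y /cube_dist_lt.
Qed.

Lemma exp_half_lt (e : R) : 0 < e -> exists N, (2^-1 : R) ^+ N < e.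
Proof.
move=> e0; have /cvgrPdist_lt/(_ _ e0)[N _ Ne] :=
  @cvg_expr R 2^-1 (ltac:(by rewrite ger0_norm ?invf_lt1 ?ltr1n)).
exists N; have := Ne N (leqnn N).
by rewrite sub0r normrN ger0_norm// exprn_ge0// invr_ge0.
Qed.

Lemma cube_openP (A : set X) :
  open A <-> forall x, A x -> exists N, forall y, agree N x y -> A y.
Proof.
rewrite openE; split=> h x Ax.
  have := h x Ax; rewrite /interior -nbhs_ballE => -[e /= e0 exA].
  have [N Ne] := exp_half_lt e0.
  exists N.+1 => y xy; apply: exA.
  by apply: (le_ball (ltW Ne)); rewrite cube_ballE.
have [N NA] := h x Ax; rewrite /interior -nbhs_ballE; exists (2^-1 ^+ N) => //=.
by rewrite cube_ballE => y xy; apply: NA; apply: agree_le xy.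
Qed.


Lemma cube_complete : complete_metric X.
Proof.
move=> F FF /cauchyP FC.
(* A small ball in the Cauchy filter freezes every coordinate of small code; the limit collects
   these eventual values. *)
pose y : X := fun i => `[< F [set x : X | x i] >].
exists y; apply/fcvg_ballP => e e0; have [N Ne] := exp_half_lt e0.
have [|x] := FC (2^-1 ^+ N); first by rewrite exprn_gt0// invr_gt0.
rewrite cube_ballE => Fx; apply: filterS (Fx) => z /= xz.
apply: (le_ball (ltW Ne)); rewrite cube_ballE /= => i iN.
rewrite -xz// /y; case xi : (x i).
  by apply/asboolP; apply: filterS Fx => t /= /(_ i iN) <-; rewrite xi.
apply/asboolP => Fi; have [t [/= ti]] := filter_ex (@filterI _ F _ _ _ Fi Fx).
by move=> /(_ i iN); rewrite xi ti.
Qed.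

(** Finitely supported points, of which there are countably many, meet every cylinder; this gives
    separability and a countable base. *)
Lemma agree_finite N (x : X) : exists s : seq I, agree N (fun i => i \in s) x.
Proof.
exists [seq i <- pmap choice.unpickle (iota 0 N) | x i] => i iN.
rewrite mem_filter mem_pmap; case: (x i) => //=.
by apply/mapP; exists (choice.pickle i); rewrite ?mem_iota// choice.pickleK.
Qed.

Lemma cube_separable : separable X.
Proof.
exists (range (fun s : seq I => (fun i => i \in s) : X)).
  by apply: (card_le_trans (card_image_le _ _)); exact: countableP.
move=> A [x Ax] /cube_openP/(_ x Ax)[N NA].
have [s sx] := agree_finite N x.
by exists (fun i => i \in s); split; [apply: NA; exact: agree_sym | exists s].
Qed.

Definition coordinate_set : set (set X) := range (fun i => [set x : X | x i]).

Lemma coordinate_open i : open [set x : X | x i].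
Proof.
by apply/cube_openP => x /= xi; exists (choice.pickle i).+1 => y /(_ i (ltnSn _)) <-.
Qed.

Local Notation coord_type := (g_sigma_algebraType coordinate_set).

(** An open set is the union of the cylinders that it contains and that are centred at finitely
    supported points. There are countably many, each cut out by coordinate conditions. *)
Lemma cube_borelE : <<s @open X >> = <<s coordinate_set >>.
Proof.
apply/seteqP; split; apply: smallest_sub; try exact: smallest_sigma_algebra.
  move=> A /cube_openP oA.
  have mi i : measurable ([set x | x i] : set coord_type).
    by apply: sub_sigma_algebra; exists i.
  suff: measurable (A : set coord_type) by [].
  pose c (p : seq I * nat) : X := fun i => i \in p.1.
  pose B (p : seq I * nat) : set coord_type :=
    [set y | agree p.2 (c p) y].
  rewrite (_ : A = [set y | exists p, (if `[< B p `<=` A >] then B p else set0) y]).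
    apply: measurable_existsT => p; case: ifP => // _.
    apply: measurable_forallT => i; case: (boolP (choice.pickle i < p.2)%N) => ip; last first.
      by rewrite [X in measurable X](_ : _ = setT)//; apply/seteqP.
    case cpi : (c p i).
      rewrite [X in measurable X](_ : _ = [set x : coord_type | x i]); first exact: mi.
      by apply/seteqP; split=> x /=; [move=> /(_ isT) <- | move=> -> ].
    rewrite [X in measurable X](_ : _ = ~` [set x : coord_type | x i]); first by apply: measurableC; exact: mi.
    apply/seteqP; split=> x /=; first by move=> /(_ isT) <-.
    by move=> /negP/negbTE ->.
  apply/seteqP; split=> y /=; last by move=> [p]; case: asboolP => // pA /pA.
  move=> /[dup] Ay /oA[N NA].
  have [s sy] := agree_finite N y.
  exists (s, N); case: asboolP => // -[].
  by move=> z /= sz; apply: NA; apply: agree_trans sz; exact: agree_sym.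
by move=> _ [i _ <-]; apply: sub_sigma_algebra; exact: coordinate_open.
Qed.

End cube_metric.

(** * The fair coin measure *)

Definition parity (I : choiceType) (u : {fset I}) (x : I -> bool) : bool :=
  \big[addb/false]_(i <- u) x i.

Section coin_measure.
Context {R : realType} {I : countType}.
Local Notation X := (cube R I).
Local Notation Y := (g_sigma_algebraType (@open (cube R I))).

(** Coordinate [i] reads the binary digit of [t] of weight 2^-(p+1), where [p] is the code of
    [i]. *)
Definition digits (t : R) : X :=
  fun i => odd (Num.truncn (2 ^+ (choice.pickle i).+1 * t)).

(** It makes all digits of [t] up to position [M] functions of the single integer
    [Num.truncn (2 ^+ M * t)]. *)
Lemma truncn_div (k M : nat) (t : R) : (k <= M)%N -> 0 <= t ->
  Num.truncn (2 ^+ k * t) = (Num.truncn (2 ^+ M * t) %/ 2 ^ (M - k))%N.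
Proof.
move=> kM t0; apply: truncn_def.
have M0 : 0 <= 2 ^+ M * t by rewrite mulr_ge0// exprn_ge0.
have /andP[l u] := truncn_itv M0.
set r := Num.truncn _ in l u *.
have e0 : 0 < (2 ^ (M - k))%:R :> R by rewrite ltr0n expn_gt0.
have eM : 2 ^+ M * t = 2 ^+ k * t * (2 ^ (M - k))%:R.
  by rewrite mulrAC natrX -exprD subnKC.
rewrite -(ler_pM2r e0) -(ltr_pM2r e0) -eM -!natrM.
rewrite (le_trans _ l) ?ler_nat ?leq_trunc_div//=.
by rewrite (lt_le_trans u)// ler_nat ltn_ceil// expn_gt0.
Qed.

Lemma measurable_truncnM (M : nat) (P : pred nat) :
  measurable [set t : R | P (Num.truncn (2 ^+ M * t))].
Proof.
have c0 : 0 < 2 ^+ M :> R by rewrite exprn_gt0.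
(* [Num.truncn] is 0 on negative reals, so its sublevel sets are half-lines unbounded below. *)
have mlt (n : nat) : measurable [set t : R | (Num.truncn (2 ^+ M * t) <= n)%N].
  rewrite (_ : mkset _ = `]-oo, (n.+1%:R / 2 ^+ M)[%classic); first exact: measurable_itv.
  by apply/seteqP; split=> t /=; rewrite in_itv/= truncn_le_nat ltr_pdivlMr// mulrC.
rewrite (_ : mkset _ = [set t | exists q, (if P q then
   [set t : R | (Num.truncn (2 ^+ M * t) <= q)%N] `\`
   (if q is q'.+1 then [set t : R | (Num.truncn (2 ^+ M * t) <= q')%N] else set0) else set0) t]).
  apply: measurable_existsT => q; case: ifP => // _; apply: measurableD => //.
  by case: q.
apply/seteqP; split=> t /= => [Pt|[q]].
  exists (Num.truncn (2 ^+ M * t)); rewrite Pt; split=> /=; first exact: leqnn.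
  by case E : (Num.truncn _) => [|q] /=; rewrite ?E ?ltnn.
case Pq : (P q) => // -[/= tq]; case: q tq Pq => [|q] /= tq Pq.
  by move: tq; rewrite leqn0 => /eqP ->.
by move=> /negP; rewrite -ltnNge => qt; rewrite (_ : Num.truncn _ = q.+1)//; apply/eqP; rewrite eqn_leq tq.
Qed.

Lemma measurable_digits : measurable_fun setT (digits : R -> Y).
Proof.
apply: (@measurability _ _ R Y setT digits (@coordinate_set R I)).
  exact: cube_borelE.
move=> _ [_ [i _ <-]] <-; rewrite setTI; exact: measurable_truncnM.
Qed.

(** The unit interval splits into [2 ^ M] intervals of length 2^-M, on each of which the integer
    part is constant. *)
Lemma lebesgue_truncn (M : nat) (P : pred nat) :
  lebesgue_measure ([set t : R | P (Num.truncn (2 ^+ M * t))] `&` `[0, 1[) =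
  ((\sum_(q < 2 ^ M) P q)%:R / 2 ^+ M)%:E.
Proof.
have c0 : 0 < 2 ^+ M :> R by rewrite exprn_gt0.
have cM (t : R) : 0 <= t -> 0 <= 2 ^+ M * t by move=> t0; rewrite mulr_ge0// ltW.
pose F (q : nat) : set R :=
  if P q then `[(q%:R / 2 ^+ M), (q.+1%:R / 2 ^+ M)[%classic else set0.
have FE q (t : R) : 0 <= t -> F q t <-> (P q /\ Num.truncn (2 ^+ M * t) = q).
  move=> t0; rewrite /F; case: ifP => Pq; last by split=> // -[].
  have -> : Num.truncn (2 ^+ M * t) = q <-> (Num.truncn (2 ^+ M * t) == q).
    by split => /eqP.
  rewrite truncn_eq ?cM//= in_itv/= ler_pdivrMr// ltr_pdivlMr//.
  by rewrite ![t * _]mulrC; split=> [//|[]].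
have F0 q (t : R) : F q t -> 0 <= t.
  rewrite /F; case: ifP => //= _; rewrite in_itv/= => /andP[+ _].
  by apply: le_trans; rewrite divr_ge0// ltW.
rewrite (_ : _ `&` _ = \big[setU/set0]_(q < 2 ^ M) F q); last first.
  rewrite -bigcup_mkord; apply/seteqP; split=> t.
    rewrite /= in_itv/= => -[Pt /andP[t0 t1]].
    exists (Num.truncn (2 ^+ M * t)); last exact/FE.
    rewrite /= truncn_lt_nat ?cM//.
    by rewrite natrX gtr_pMr.
  move=> [q /= qM Fq]; have t0 := F0 _ _ Fq.
  move: Fq => /(FE _ _ t0)[Pq tq]; rewrite tq in_itv/= t0; split=> //=.
  move: qM; rewrite -tq truncn_lt_nat ?cM//.
  by rewrite natrX gtr_pMr.
rewrite measure_bigsetU; last 2 first.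
- by move=> q; rewrite /F; case: ifP => // _; exact: measurable_itv.
- move=> p q _ _ [t [pt qt]]; have t0 := F0 _ _ pt.
  by move: pt qt => /(FE _ _ t0)[_ <-] /(FE _ _ t0)[_ <-].
rewrite natr_sum mulr_suml -sumEFin; apply: eq_bigr => q _.
rewrite /F; case: (P q) => /=; last by rewrite measure0 mul0r.
rewrite lebesgue_measure_itv/= lte_fin ltr_pM2r ?invr_gt0// ltr_nat ltnSn.
by rewrite -EFinD -mulrBl -natrB// subSnn.
Qed.

Lemma sum_nat_pairs (F : nat -> nat) n :
  (\sum_(q < 2 * n) F q = \sum_(a < n) (F (2 * a) + F (2 * a).+1))%N.
Proof.
elim: n => [|n IH]; first by rewrite muln0 !big_ord0.
by rewrite mulnS !big_ord_recr /= IH addnA.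
Qed.

(* Flipping the last relevant binary digit flips the parity. *)
Lemma lebesgue_parity (u : {fset I}) : u != fset0 ->
  lebesgue_measure ([set t : R | parity u (digits t)] `&` `[0, 1[) = (2^-1)%:E.
Proof.
case/fset0Pn => i1 i1u.
have [i0 i0u i0max] : exists2 i0, i0 \in u &
    forall i, i \in u -> (choice.pickle i <= choice.pickle i0)%N.
  pose A := [arg max_(i > [` i1u]%fset) choice.pickle (val i)]%N.
  exists (val A); first exact: valP.
  move=> i iu; rewrite /A; case: arg_maxnP => // j _ /(_ [` iu]%fset); exact.
set M := choice.pickle i0.
pose P (q : nat) := \big[addb/false]_(i <- u) odd (q %/ 2 ^ (M - choice.pickle i)).
(* As [M] is the largest code in [u], the last bit [b] of [q] is read by [i0] alone, and the other
   coordinates depend only on [a]. So exactly one of [2a] and [2a + 1] satisfies [P]. *)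
have P2 a (b : bool) : P (2 * a + b)%N =
    b (+) \big[addb/false]_(i <- (u `\ i0)%fset) odd (a %/ 2 ^ (M - (choice.pickle i).+1)).
  rewrite /P (big_fsetD1 i0)//= subnn expn0 divn1 oddD mul2n odd_double oddb; congr addb.
  apply: eq_big_seq => i; rewrite in_fsetD1 => /andP[ii0 iu].
  have iM : (choice.pickle i < M)%N.
    rewrite ltn_neqAle i0max// andbT; apply: contra ii0 => /eqP h.
    by apply/eqP; apply: (pcan_inj choice.pickleK).
  rewrite -(subnSK iM) expnS divnMA -muln2 divnMDl//.
  by rewrite (divn_small (_ : b < 2)%N) ?addn0//; case: b.
rewrite (_ : [set t : R | _] `&` _ = [set t : R | P (Num.truncn (2 ^+ M.+1 * t))] `&` `[0, 1[).
  rewrite lebesgue_truncn expnS (sum_nat_pairs (fun q => nat_of_bool (P q))).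
  rewrite (eq_bigr (fun=> 1%N)) ?sum1_card ?card_ord; last first.
    move=> a _; have := P2 a false; have := P2 a true; rewrite addn0 addn1 => -> ->.
    by case: (\big[_/_]_(_ <- _) _).
  by rewrite natrX exprS invfM mulrA mulrAC divff ?mul1r// expf_neq0.
have PE t : 0 <= t -> P (Num.truncn (2 ^+ M.+1 * t)) = parity u (digits t).
  move=> t0; rewrite /P /parity; apply: eq_big_seq => i iu.
  by rewrite /digits (@truncn_div _ M.+1)// ?ltnS ?i0max// subSS.
by apply/seteqP; split=> t [/= p /[dup] t01]; rewrite /= in_itv/= => /andP[t0 _]; split=> //=;
  move: p; rewrite PE.
Qed.
(** The fair product measure, obtained as the law of the binary digits of a uniform point of the
    unit interval. *)
Definition coin : set Y -> \bar R :=
  pushforward (mrestr lebesgue_measure (measurable_itv `[0%R : R, 1%R[)) (digits : R -> Y).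

Let coin0 : coin set0 = 0%E.
Proof. by rewrite /coin /pushforward preimage_set0 measure0. Qed.

Let coin_ge0 A : (0 <= coin A)%E.
Proof. by rewrite /coin /pushforward measure_ge0. Qed.

Let coin_sigma_additive : semi_sigma_additive coin.
Proof. by have mf := measurable_digits; exact: measure_semi_sigma_additive. Qed.

HB.instance Definition _ := isMeasure.Build _ _ _ coin coin0 coin_ge0 coin_sigma_additive.

Let coin_setT : coin setT = 1%E.
Proof.
rewrite /coin /pushforward /mrestr preimage_setT setTI lebesgue_measure_itv/=.
by rewrite lte_fin ltr01 -EFinD subr0.
Qed.

HB.instance Definition _ := Measure_isProbability.Build _ _ _ coin coin_setT.

Lemma coin_parity (u : {fset I}) : u != fset0 ->
  coin [set x : Y | parity u x] = (2^-1)%:E.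
Proof. exact: lebesgue_parity. Qed.

End coin_measure.

(** * Walsh functions *)

Section symmetric_difference.
Context {I : choiceType}.
Implicit Types u v : {fset I}.

Definition fsetY u v : {fset I} := ((u `\` v) `|` (v `\` u))%fset.

Lemma in_fsetY u v i : (i \in fsetY u v) = (i \in u) (+) (i \in v).
Proof. by rewrite !inE; case: (i \in u); case: (i \in v). Qed.

Lemma fsetY_eq0 u v : (fsetY u v == fset0) = (u == v).
Proof.
apply/eqP/eqP => [uv|->]; apply/fsetP => i.
  by have := in_fsetY u v i; rewrite uv inE; case: (i \in u); case: (i \in v).
by rewrite in_fsetY addbb inE.
Qed.

Lemma parity0 x : @parity I fset0 x = false.
Proof. by rewrite /parity big_seq_fset0. Qed.

Lemma parity1 i x : @parity I [fset i]%fset x = x i.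
Proof. by rewrite /parity big_seq_fset1. Qed.

Lemma parityY u v x : parity (fsetY u v) x = parity u x (+) parity v x.
Proof.
have parityS w : (w `<=` u `|` v)%fset ->
    parity w x = \big[addb/false]_(i <- (u `|` v)%fset) ((i \in w) && x i).
  move=> wuv; rewrite -(big_fset_incl _ wuv); last by move=> i _ /negbTE ->.
  by apply: eq_big_seq => i ->.
rewrite !parityS ?fsubsetUl ?fsubsetUr//; last first.
  by apply/fsubsetP => i; rewrite in_fsetY in_fsetU; case: (i \in u).
rewrite -big_split; apply: eq_bigr => i _; rewrite in_fsetY.
by case: (i \in u); case: (i \in v); case: (x i).
Qed.

Lemma parity_imfset (f : I -> I) u x : injective f ->
  parity (f @` u)%fset x = parity u (x \o f).
Proof. by move=> fI; rewrite /parity big_imfset// => i j _ _; exact: fI. Qed.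

End symmetric_difference.

Section walsh.
Context {R : realType} {I : countType}.
Local Notation X := (cube R I).
Local Notation Y := (g_sigma_algebraType (@open (cube R I))).
Local Notation mu := (@coin R I).
Implicit Types (u v : {fset I}) (x : Y).

(** The characters of the compact group (Z/2)^I. *)
Definition walsh u x : R := (-1) ^+ parity u x.

Lemma walsh0 x : walsh fset0 x = 1.
Proof. by rewrite /walsh parity0. Qed.

Lemma walshY u v x : walsh (fsetY u v) x = walsh u x * walsh v x.
Proof. by rewrite /walsh parityY signr_addb. Qed.

Lemma walsh_agree u : exists N, forall x y : X, agree N x y -> walsh u x = walsh u y.
Proof.
exists (\max_(i <- u) choice.pickle i).+1 => x y xy; rewrite /walsh; congr (_ ^+ nat_of_bool _).
by apply: eq_big_seq => i iu; apply: xy; rewrite ltnS; exact: leq_bigmax_seq.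
Qed.

Lemma measurable_parity u : measurable [set x : Y | parity u x].
Proof.
apply: sub_sigma_algebra; apply/cube_openP => x /= ux.
have [N uN] := walsh_agree u; exists N => y /uN; rewrite /walsh ux.
by case: (parity u y) => // /eqP; rewrite -subr_eq0 -opprD oppr_eq0 (_ : 1 + 1 = 2%:R)// pnatr_eq0.
Qed.

Lemma walshE u : walsh u = (fun x => 1 + (- 2) * \1_[set x : Y | parity u x] x) :> (Y -> R).
Proof.
apply/funext => x; rewrite /walsh indicE; case: (boolP (parity u x)) => ux.
  by rewrite mem_set// mulr1 opprD addNKr.
by rewrite memNset ?mulr0 ?addr0//; exact/negP.
Qed.

Lemma integrable_walsh u : mu.-integrable setT (EFin \o walsh u).
Proof.
rewrite walshE; apply: (@eq_integrable _ _ _ mu setT measurableT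
  (cst 1%E \+ (fun x : Y => (- 2)%:E * (\1_[set x : Y | parity u x] x)%:E))%E).
  by move=> x _ /=; rewrite EFinD EFinM.
apply: integrableD => //; first exact: finite_measure_integrable_cst.
by apply: integrableZl => //; apply: integrable_indic; exact: measurable_parity.
Qed.

Lemma Rintegral_indic (A : set Y) : measurable A ->
  \int[mu]_x \1_A x = fine (mu A).
Proof. by move=> mA; rewrite /Rintegral integral_indic// setIT. Qed.

Lemma Rintegral_walsh u : \int[mu]_x walsh u x = (u == fset0)%:R.
Proof.
rewrite walshE; have mu1 : mu.-integrable setT (EFin \o \1_[set x : Y | parity u x]).
  by apply: integrable_indic; exact: measurable_parity.
rewrite RintegralD//; last 2 first.
- exact: finite_measure_integrable_cst.
- by apply: (@eq_integrable _ _ _ mu setT measurableT _ _ _ (integrableZl measurableT (-2) mu1)).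
rewrite Rintegral_cst// RintegralZl// Rintegral_indic; last exact: measurable_parity.
rewrite mul1r [fine _](congr1 fine (probability_setT mu)) /=; case: (eqVneq u fset0) => [->|u0]; last first.
  by rewrite coin_parity//=; field.
by rewrite (_ : [set x | _] = set0) ?measure0 ?mulr0 ?addr0//; apply/seteqP; split=> x //=; rewrite parity0.
Qed.

(** A set [u] may occur several times in the list, so that sums and products of polynomials are
    plain list operations; [coef] and [supp] give the normal form. *)
Definition wpoly (s : seq (R * {fset I})) x : R := \sum_(p <- s) p.1 * walsh p.2 x.

Lemma integrable_wpoly s : mu.-integrable setT (EFin \o wpoly s).
Proof.
elim: s => [|p s IH].
  apply: (@eq_integrable _ _ _ mu setT measurableT (cst 0%E)).
    by move=> x _ /=; rewrite /wpoly big_nil.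
  exact: finite_measure_integrable_cst.
apply: (@eq_integrable _ _ _ mu setT measurableT
  ((fun x => p.1%:E * (walsh p.2 x)%:E) \+ (EFin \o wpoly s))%E).
  by move=> x _ /=; rewrite /wpoly big_cons.
apply: integrableD => //; apply: integrableZl => //; exact: integrable_walsh.
Qed.

Lemma Rintegral_wpoly s : \int[mu]_x wpoly s x = \sum_(p <- s | p.2 == fset0) p.1.
Proof.
elim: s => [|p s IH].
  rewrite big_nil (_ : wpoly [::] = cst 0) ?Rintegral_cst ?mul0r//.
  by apply/funext => x; rewrite /wpoly big_nil.
rewrite (_ : wpoly (p :: s) = (fun x => p.1 * walsh p.2 x + wpoly s x)); last first.
  by apply/funext => x; rewrite /wpoly big_cons.
rewrite RintegralD//; last 2 first.
- by apply: (@eq_integrable _ _ _ mu setT measurableT _ _ _ (integrableZl measurableT p.1 (integrable_walsh p.2))).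
- exact: integrable_wpoly.
rewrite RintegralZl//; last exact: integrable_walsh.
rewrite IH Rintegral_walsh big_cons; case: eqP => _; by rewrite ?mulr1// mulr0 add0r.
Qed.

Definition walsh_rep s (C : set Y) := forall x, \1_C x = wpoly s x.

(** Such sets depend on finitely many coordinates and have a finite Fourier expansion. They form the
    algebra used to approximate Borel sets. *)
Definition walsh_set : set (set Y) := [set C | exists s, walsh_rep s C].

Lemma walsh_set_measurable C : walsh_set C -> measurable C.
Proof.
move=> [s sC]; apply: sub_sigma_algebra; apply/cube_openP => x Cx.
have [N sN] : exists N, forall x y : X, agree N x y -> wpoly s x = wpoly s y.
  elim: s {sC} => [|p s [N IH]]; first by exists 0%N => *; rewrite /wpoly !big_nil.
  have [M pM] := walsh_agree p.2; exists (maxn M N) => y z yz.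
  rewrite /wpoly !big_cons; congr (_ * _ + _).
    by apply: pM; apply: agree_le yz; exact: leq_maxl.
  by apply: IH; apply: agree_le yz; exact: leq_maxr.
exists N => y /sN; rewrite -!sC !indicE mem_set//.
by case: (boolP (y \in C)) => [/set_mem//|_ /eqP]; rewrite oner_eq0.
Qed.

Lemma walsh_rep_measure s C : walsh_rep s C ->
  mu C = (\sum_(p <- s | p.2 == fset0) p.1)%:E.
Proof.
move=> sC; have mC : measurable C by apply: walsh_set_measurable; exists s.
rewrite -Rintegral_wpoly -(_ : \1_C = wpoly s); last exact/funext.
by rewrite Rintegral_indic// fineK// fin_num_measure.
Qed.

Lemma walsh_setC C : walsh_set C -> walsh_set (~` C).
Proof.
move=> [s sC]; exists ((1, fset0) :: [seq (- p.1, p.2) | p <- s]) => x.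
rewrite /wpoly big_cons big_map /= walsh0 mulr1.
under eq_bigr do rewrite mulNr.
by rewrite sumrN -/(wpoly s x) -sC !indicE in_setC; case: (x \in C); rewrite ?subrr ?subr0.
Qed.

Lemma walsh_repI s t C D : walsh_rep s C -> walsh_rep t D ->
  walsh_rep [seq (p.1 * q.1, fsetY p.2 q.2) | p <- s, q <- t] (C `&` D).
Proof.
move=> sC tD x; rewrite indicI /= sC tD /wpoly big_allpairs_dep /= mulr_suml.
apply: eq_bigr => p _; rewrite mulr_sumr; apply: eq_bigr => q _.
by rewrite walshY mulrACA.
Qed.

Lemma walsh_setI C D : walsh_set C -> walsh_set D -> walsh_set (C `&` D).
Proof. by move=> [s sC] [t tD]; eexists; exact: walsh_repI sC tD. Qed.

Lemma walsh_set_coord i : walsh_set [set x : Y | x i].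
Proof.
exists [:: (2^-1, fset0); (- 2^-1, [fset i]%fset)] => x.
rewrite /wpoly !big_cons big_nil /= walsh0 /walsh parity1 indicE addr0 mulr1.
case: (boolP (x i)) => xi; first by rewrite mem_set//=; field.
by rewrite memNset ?mulr1 ?subrr//; exact/negP.
Qed.

Definition coef (s : seq (R * {fset I})) u := \sum_(p <- s | p.2 == u) p.1.
Definition supp (s : seq (R * {fset I})) : seq {fset I} := undup [seq p.2 | p <- s].

Lemma coef_out s u : u \notin supp s -> coef s u = 0.
Proof.
move=> us; rewrite /coef big_seq_cond big_pred0// => p.
apply/negP => /andP[ps /eqP pu]; move/negP: us; apply.
by rewrite mem_undup -pu map_f.
Qed.

Lemma wpoly_normal s : wpoly [seq (coef s u, u) | u <- supp s] = wpoly s.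
Proof.
apply/funext => x; rewrite /wpoly big_map /=.
under eq_bigr do rewrite /coef mulr_suml.
rewrite (exchange_big_dep xpredT)//=.
rewrite big_seq [RHS]big_seq; apply: eq_bigr => p ps.
rewrite (eq_bigl (pred1 p.2)) => [|u]; last by rewrite eq_sym.
by rewrite -big_filter filter_pred1_uniq ?big_seq1// ?undup_uniq// mem_undup map_f.
Qed.

Lemma walsh_rep_pullback s C (f : I -> I) : injective f -> walsh_rep s C ->
  walsh_rep [seq (p.1, (f @` p.2)%fset) | p <- s] [set x : Y | C (x \o f)].
Proof.
move=> fI sC x; rewrite /wpoly big_map /=.
under eq_bigr do rewrite /walsh parity_imfset//.
exact: sC.
Qed.

(** Orthogonality: in the product of the two normal forms, a pair [(u, v)] has nonzero integral only
    if the symmetric difference of [u] and the image of [v] is empty. *)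
Lemma coin_corr s t C D (f : I -> I) : injective f -> walsh_rep s C -> walsh_rep t D ->
  mu (C `&` [set x : Y | D (x \o f)]) =
  (\sum_(v <- supp t) coef s (f @` v)%fset * coef t v)%:E.
Proof.
move=> fI sC tD.
have sC' : walsh_rep [seq (coef s u, u) | u <- supp s] C by move=> x; rewrite wpoly_normal.
have tD' : walsh_rep [seq (coef t u, u) | u <- supp t] D by move=> x; rewrite wpoly_normal.
rewrite (walsh_rep_measure (walsh_repI sC' (walsh_rep_pullback fI tD'))); congr EFin.
rewrite big_mkcond big_allpairs_dep big_map exchange_big /= -map_comp big_map.
apply: eq_bigr => v _ /=; rewrite -big_mkcond/=.
rewrite (eq_bigl (pred1 (f @` v)%fset)) => [|u]; last by rewrite fsetY_eq0.
rewrite -big_filter; case: (boolP ((f @` v)%fset \in supp s)) => vs.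
  by rewrite filter_pred1_uniq ?big_seq1// ?undup_uniq.
rewrite (coef_out vs) mul0r big1_seq// => u; rewrite mem_filter /= => /andP[/eqP ->].
by rewrite (negbTE vs).
Qed.

End walsh.

(** * Approximation by Walsh sets *)

Section algebra_approximation.
Context {R : realType} {d : measure_display} {T : measurableType d}.
Variables (mu : probability T R) (G : set (set T)).
Hypothesis mG : @measurable d T = <<s G >>.
Hypothesis GT : G setT.
Hypothesis GC : forall A, G A -> G (~` A).
Hypothesis GI : setI_closed G.

Let approximable : set (set T) := [set B | measurable B /\
  forall e : R, 0 < e -> exists2 C, G C & (mu (B `+` C) <= e%:E)%E].

Let G_measurable C : G C -> measurable C.
Proof. by move=> GC'; rewrite mG; exact: sub_sigma_algebra. Qed.

Let GU A B : G A -> G B -> G (A `|` B).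
Proof. by move=> GA GB; rewrite -[_ `|` _]setCK setCU; apply/GC/GI; exact: GC. Qed.

Let measurableY (A B : set T) : measurable A -> measurable B -> measurable (A `+` B).
Proof. by move=> mA mB; apply: measurableU; exact: measurableD. Qed.

(** Serves as the triangle inequality for the pseudometric [mu (A]+[B)]. *)
Let measureY_trans (A B C E F : set T) : measurable A -> measurable B ->
  measurable C -> measurable E -> measurable F ->
  A `<=` (B `+` C) `|` (E `+` F) -> (mu A <= mu (B `+` C) + mu (E `+` F))%E.
Proof.
move=> mA mB mC mE mF ABC; have mBC := measurableY mB mC; have mEF := measurableY mE mF.
apply: (@le_trans _ _ (mu ((B `+` C) `|` (E `+` F)))).
  by apply: le_measure; rewrite ?inE//; exact: measurableU.
exact: measureU2.
Qed.

Let approximable_closed B : measurable B ->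
  (forall e : R, 0 < e -> exists2 A, approximable A & (mu (B `+` A) <= e%:E)%E) ->
  approximable B.
Proof.
move=> mB BA; split=> // e e0; have e20 : 0 < e / 2 by rewrite divr_gt0.
have [A [mA AG] BAe] := BA _ e20; have [C GC' ACe] := AG _ e20.
exists C => //; rewrite [e]splitr EFinD; apply: le_trans (leeD BAe ACe).
have mC := G_measurable GC'.
apply: measureY_trans => //; first exact: measurableY.
by move=> x [[Bx Cx]|[Cx Bx]]; have [Ax|Ax] := pselect (A x); rewrite /setY/=; tauto.
Qed.

Let approximableU A B : approximable A -> approximable B -> approximable (A `|` B).
Proof.
move=> [mA AG] [mB BG]; split=> [|e e0]; first exact: measurableU.
have e20 : 0 < e / 2 by rewrite divr_gt0.
have [C GC' ACe] := AG _ e20; have [D GD BDe] := BG _ e20.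
exists (C `|` D); first exact: GU.
rewrite [e]splitr EFinD; apply: le_trans (leeD ACe BDe).
have mC := G_measurable GC'; have mD := G_measurable GD.
apply: measureY_trans => //; first by apply: measurableY; exact: measurableU.
by move=> x; rewrite /setY/=; tauto.
Qed.

(** Complements leave symmetric differences unchanged. By continuity from below, a countable union
    is close to one of its finite subunions, and these are approximable by induction. *)
Let approximable_sigma : sigma_algebra setT approximable.
Proof.
have GA C : G C -> approximable C.
  move=> GC'; split=> [|e e0]; first exact: G_measurable.
  by exists C => //; rewrite setYK measure0 lee_fin ltW.
split.
- by rewrite -setCT; apply/GA/GC.
- move=> A [mA AG]; split=> [|e e0]; first exact: measurableD.
  have [C GC' ACe] := AG _ e0; exists (~` C); first exact: GC.
  rewrite (_ : _ `+` _ = A `+` C)//; apply/seteqP; split=> x; rewrite /setY/=; last by tauto.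
  by have [?|?] := pselect (A x); have [?|?] := pselect (C x); tauto.
move=> A AG.
pose F n := \big[setU/set0]_(i < n.+1) A i.
have mAn n : measurable (A n) by have [] := AG n.
have mF n : measurable (F n) by apply: bigsetU_measurable.
have AF n : approximable (F n).
  elim: n => [|n IH]; rewrite /F big_ord_recr/= ?big_ord0 ?set0U//.
  exact: approximableU.
have mU : measurable (\bigcup_k A k) by exact: bigcupT_measurable.
apply: approximable_closed => // e e0.
have FU : \bigcup_n F n = \bigcup_k A k.
  exact: bigcup_bigsetU_bigcup.
have := @nondecreasing_cvg_mu _ _ _ mu F mF (bigcupT_measurable _ mF).
have ndF : nondecreasing_seq F.
  by move=> m n mn; apply/subsetPset; exact: subset_bigsetU.
move=> /(_ ndF); rewrite FU => FmU.
have finU : mu (\bigcup_k A k) \is a fin_num by exact: fin_num_measure.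
have /fine_cvgP[_ /cvgrPdist_le/(_ _ e0)[N _ /(_ N (leqnn N))]] : (mu \o F) n @[n --> \oo] --> (fine (mu (\bigcup_k A k)))%:E.
  by rewrite fineK.
move=> /= Ne; exists (F N) => //.
have FNU : F N `<=` \bigcup_k A k by rewrite -FU; exact: bigcup_sup.
rewrite /setY (_ : F N `\` _ = set0) ?setU0; last by apply/seteqP; split=> x // [/FNU].
rewrite measureD//; last by rewrite -ge0_fin_numE// fin_num_measure.
have finF : mu (F N) \is a fin_num by exact: fin_num_measure.
rewrite setIidr// -[leLHS]fineK ?fin_numB ?finU ?finF// fineB// lee_fin.
by apply: le_trans Ne; exact: ler_norm.
Qed.

Lemma algebra_approximation B (e : R) : measurable B -> 0 < e ->
  exists2 C, G C & (mu (B `+` C) <= e%:E)%E.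
Proof.
move=> mB; suff [_] : approximable B by apply.
move: B mB; rewrite mG; apply: smallest_sub => // C GC'.
split=> [|e' e0]; first exact: G_measurable.
by exists C => //; rewrite setYK measure0 lee_fin ltW.
Qed.

End algebra_approximation.

(** * Density of Walsh sets and invariance of the coin measure *)

Section coin_invariance.
Context {R : realType} {I : countType}.
Local Notation Y := (g_sigma_algebraType (@open (cube R I))).
Local Notation mu := (@coin R I).

Lemma walsh_set_generates : @measurable _ Y = <<s @walsh_set R I >>.
Proof.
apply/seteqP; split; last first.
  apply: smallest_sub; first exact: (@sigma_algebra_measurable _ Y).
  by move=> C; exact: walsh_set_measurable.
rewrite [X in X `<=` _](@cube_borelE R I).
apply: smallest_sub; first exact: smallest_sigma_algebra.
by move=> _ [i _ <-]; apply: sub_sigma_algebra; exact: walsh_set_coord.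
Qed.

Lemma walsh_setT : walsh_set (setT : set Y).
Proof.
by exists [:: (1, fset0)] => x; rewrite indicT /wpoly big_seq1 walsh0 mulr1.
Qed.

Lemma coin_approximation (B : set Y) (e : R) : measurable B -> 0 < e ->
  exists2 C, walsh_set C & (mu (B `+` C) <= e%:E)%E.
Proof.
apply: algebra_approximation; first exact: walsh_set_generates.
- exact: walsh_setT.
- exact: walsh_setC.
- exact: walsh_setI.
Qed.

Lemma measurable_coord i : measurable [set x : Y | x i].
Proof. by apply: walsh_set_measurable; exact: walsh_set_coord. Qed.

Definition pullback (f : I -> I) (x : Y) : Y := x \o f.

Lemma measurable_pullback f : measurable_fun setT (pullback f).
Proof.
apply: (@measurability _ _ Y Y setT (pullback f) (@coordinate_set R I)).
  exact: cube_borelE.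
by move=> _ [_ [i _ <-]] <-; rewrite setTI; exact: measurable_coord.
Qed.

(** Walsh sets form a generating pi-system, so it suffices to compare both measures there. The
    measure of a Walsh set is its constant coefficient, and the image of [u] is empty only if [u]
    is. *)
Lemma coin_pullback f (D : set Y) : injective f -> measurable D ->
  mu (pullback f @^-1` D) = mu D.
Proof.
move=> fI mD; have mf := measurable_pullback f.
apply/esym; apply: (@measure_unique _ _ Y (@walsh_set R I) (fun=> setT) _ _ _ _
  mu (pushforward mu (pullback f))) => //.
- exact: walsh_set_generates.
- exact: walsh_setI.
- by move=> _; exact: walsh_setT.
- by rewrite bigcup_const.
- move=> C [s sC]; apply: (etrans (walsh_rep_measure sC)); apply/esym.
  apply: (etrans (walsh_rep_measure (walsh_rep_pullback fI sC))).
  rewrite big_map; congr EFin.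
  apply: eq_bigl => p /=; apply/eqP/eqP => [p0|->]; last by rewrite imfset0.
  apply/fsetP => i; rewrite inE; apply/negP => ip.
  by have := in_imfset imfset_key f ip; rewrite p0 inE.
- by move=> _; apply: le_lt_trans (probability_le1 mu measurableT) _; rewrite ltry.
Qed.

End coin_invariance.

(** * Reduced words and the spectral gap *)

Section reduced_words.
Context {S : finType}.
Implicit Types (s t : S) (w : seq S).

Definition reduced w := sorted (fun a b => a != b) w.

(** The free product [Gamma], represented by normal forms; [act s] below is left multiplication by
    the generator [s]. *)
Definition rword := {w : seq S | reduced w}.
Implicit Types (g : rword) (u : {fset rword}).

Definition act_seq s w :=
  if w is t :: w' then if t == s then w' else s :: w else [:: s].

Lemma reduced_act_seq s w : reduced w -> reduced (act_seq s w).
Proof.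
case: w => //= t w tw; case: eqP => [_|/eqP ts] /=; last by rewrite eq_sym ts.
by case: w tw => //= ? ? /andP[].
Qed.

Definition act s g : rword := exist (fun w => reduced w) _ (reduced_act_seq s (valP g)).

(** If a leading [s] was cancelled, reducedness makes the next letter differ from [s], so a second
    application restores it. *)
Lemma actK s : involutive (act s).
Proof.
move=> g; apply: val_inj; case: g => -[|t w] /= tw; rewrite /act_seq /= ?eqxx//.
case: (eqVneq t s) => [<-|ts] /=; last by rewrite eqxx.
by case: w tw => //= r w /andP[tr _]; rewrite eq_sym (negbTE tr).
Qed.

Lemma act_inj s : injective (act s).
Proof. exact: inv_inj (actK s). Qed.

Definition starts s g := ohead (val g) == Some s.

Lemma starts_act s g : starts s (act s g) = ~~ starts s g.
Proof.
case: g => -[|t w] /= tw; rewrite /starts /= ?eqxx// (inj_eq Some_inj).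
case: (eqVneq t s) tw => [->|_ _] /=; last by rewrite eqxx.
by case: w => //= r w /andP[/negbTE sr _]; rewrite (inj_eq Some_inj) eq_sym sr.
Qed.

Definition dominant s u : bool :=
  (\sum_(g <- u) 1 <= 2 * \sum_(g <- u) starts s g)%N.

(** [act s] exchanges words starting with [s] and the others, so the counts of words starting with
    [s] in [u] and in its image add up to the size of [u]. *)
Lemma dominant_act s u : dominant s u || dominant s (act s @` u)%fset.
Proof.
have actE (F : rword -> nat) :
    (\sum_(g <- (act s @` u)%fset) F g = \sum_(g <- u) F (act s g))%N.
  by rewrite big_imfset// => g h _ _; exact: act_inj.
have -> : dominant s (act s @` u)%fset =
    (\sum_(g <- u) 1 <= 2 * \sum_(g <- u) ~~ starts s g)%N.
  rewrite /dominant !actE; congr (_ <= 2 * _)%N.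
  by apply: eq_bigr => g _; rewrite starts_act.
rewrite /dominant.
have -> : (\sum_(g <- u) 1 = \sum_(g <- u) starts s g + \sum_(g <- u) ~~ starts s g)%N.
  by rewrite -big_split; apply: eq_bigr => g _; case: starts.
by move: (\sum_(g <- u) _)%N (\sum_(g <- u) _)%N => m n; lia.
Qed.

(** A word has at most one first letter, so the counts for distinct letters add up to at most the
    size of [u], while each dominant letter takes at least half of it. *)
Lemma dominant_le2 (J : finType) (e : J -> S) u : injective e -> u != fset0 ->
  (\sum_(a : J) dominant (e a) u <= 2)%N.
Proof.
move=> eI u0; set N := (\sum_(g <- u) 1)%N.
have N0 : (0 < N)%N by rewrite /N sum1_size -[size _]/(#|` u|) cardfs_gt0.
rewrite -(leq_pmul2r N0) big_distrl /=.
apply: (@leq_trans (\sum_(a : J) 2 * \sum_(g <- u) starts (e a) g)%N).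
  by apply: leq_sum => a _; case: (boolP (dominant _ _)); rewrite ?mul1n ?mul0n.
rewrite -big_distrr leq_mul2l /= exchange_big /=; apply: leq_sum => g _.
case: (pickP (fun a => starts (e a) g)) => [a ga|g0]; last by rewrite big1// => a _; rewrite g0.
rewrite (bigD1 a)//= big1 ?addn0 ?leq_b1// => b ba.
rewrite /starts; move: ga; rewrite /starts => /eqP ->; rewrite (inj_eq Some_inj).
by apply/eqP; rewrite eqb0; apply: contra ba => /eqP/eI ->.
Qed.

End reduced_words.
Arguments rword : clear implicits.

Lemma ler_sum_support (R : numDomainType) (T : eqType) (l l' : seq T) (h : T -> R) :
  uniq l -> uniq l' -> (forall u, 0 <= h u) ->
  (forall u, u \in l -> u \notin l' -> h u = 0) ->
  \sum_(u <- l) h u <= \sum_(u <- l') h u.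
Proof.
move=> ul ul' h0 hl.
have -> : \sum_(u <- l) h u = \sum_(u <- l' | u \in l) h u.
  rewrite (bigID (mem l')) /= [X in _ + X]big1_seq ?addr0; last first.
    by move=> u /andP[/hl ul'' /ul''].
  rewrite -big_filter -[RHS]big_filter; apply: perm_big; apply: uniq_perm; rewrite ?filter_uniq// => u.
  by rewrite !mem_filter andbC.
rewrite [leRHS](bigID (mem l)) /= lerDl; exact: sumr_ge0.
Qed.

(** * Fourier lower bound for averaged correlations *)

Section spectral_gap.
Context {R : realType} {S : finType}.
Local Notation I := (rword S).
Local Notation Y := (g_sigma_algebraType (@open (cube R I))).
Local Notation mu := (@coin R I).
Implicit Types (s t : seq (R * {fset I})) (C D : set Y).

(** The correlation of [C] with itself is the sum of the squared coefficients, and it equals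
    [mu C]. *)
Lemma parseval s C : walsh_rep s C -> \sum_(u <- supp s) coef s u ^+ 2 <= 1.
Proof.
move=> sC; have := coin_corr (@inj_id I) sC sC.
rewrite (_ : _ `&` _ = C); last by apply/seteqP; split=> x; [case | split].
under eq_bigr do rewrite imfset_id -expr2.
move=> h; rewrite -lee_fin -h; apply: probability_le1.
by apply: walsh_set_measurable; exists s.
Qed.

Lemma spectral_gap (J : finType) (e : J -> S) (r : R) s t C D :
  injective e -> 0 < r -> walsh_rep s C -> walsh_rep t D ->
  #|J|%:R * (fine (mu C) * fine (mu D)) - (r * #|J|%:R + 2 / r) <=
  \sum_(a : J) fine (mu (C `&` pullback (act (e a)) @^-1` D)).
Proof.
move=> eI r0 sC tD.
pose c := coef s; pose d := coef t; pose ac a (v : {fset I}) : {fset I} := (act (e a) @` v)%fset.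
have acI a : injective (ac a).
  move=> u v uv; apply/fsetP => g; have := congr1 (fun z : {fset I} => act (e a) g \in z) uv.
  by rewrite !mem_imfset//; exact: act_inj.
have ac0 a v : (ac a v == fset0) = (v == fset0).
  have {1}<- : ac a fset0 = fset0 by exact: imfset0.
  by rewrite (inj_eq (acI a)).
have muE C' s' : walsh_rep s' C' -> fine (mu C') = coef s' fset0.
  by move=> sC'; rewrite (walsh_rep_measure sC').
pose L := [seq v <- supp t | v != fset0]; pose K := [seq v <- supp s | v != fset0].
(* The empty set is fixed by the action and contributes the product of the two measures; only the
   other terms need an estimate. *)
have corr a : fine (mu (C `&` pullback (act (e a)) @^-1` D)) =
    c fset0 * d fset0 + \sum_(v <- L) c (ac a v) * d v.
  rewrite [X in fine X](coin_corr (act_inj (s := e a)) sC tD) /=.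
  rewrite (bigID (pred1 fset0)) /= -[X in _ + X]big_filter; congr (_ + _).
  rewrite -big_filter; case: (boolP (fset0 \in supp t)) => t0.
    by rewrite filter_pred1_uniq ?undup_uniq// big_seq1 imfset0.
  rewrite /d (coef_out t0) mulr0 big1_seq// => u; rewrite mem_filter /= => /andP[/eqP ->].
  by rewrite (negbTE t0).
under eq_bigr do rewrite corr.
have sumJ (x : R) : \sum_(a : J) x = #|J|%:R * x by rewrite sumr_const mulr_natl.
rewrite (muE _ _ sC) (muE _ _ tD) big_split /= sumJ lerD2l.
pose p a v : R := (dominant (e a) v)%:R.
(* AM-GM with weights [r] and [1/r], the weight [1/r] being put on a dominant side. *)
have amgm a v : - (c (ac a v) * d v) <=
    r / 2 * (c (ac a v) ^+ 2 + d v ^+ 2) +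
    (2 * r)^-1 * (p a v * d v ^+ 2 + p a (ac a v) * c (ac a v) ^+ 2).
  have amgm2 (x y : R) : - (x * y) <= r / 2 * x ^+ 2 + (2 * r)^-1 * y ^+ 2.
    rewrite -subr_ge0 (_ : _ - _ = (2 * r)^-1 * (r * x + y) ^+ 2).
      by rewrite mulr_ge0 ?sqr_ge0// invr_ge0 mulr_ge0// ltW.
    by field; rewrite gt_eqF.
  have r20 : 0 <= r / 2 by rewrite divr_ge0// ltW.
  have ri0 : 0 <= (2 * r)^-1 by rewrite invr_ge0 mulr_ge0// ltW.
  have p0 b w : 0 <= p b w by rewrite ler0n.
  have := amgm2 (c (ac a v)) (d v); have := amgm2 (d v) (c (ac a v)).
  have x2 := sqr_ge0 (c (ac a v)); have y2 := sqr_ge0 (d v).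
  have := mulr_ge0 r20 x2; have := mulr_ge0 r20 y2.
  rewrite !mulrDr [d v * _]mulrC.
  have /orP[h|h] := dominant_act (e a) v.
    rewrite [p a v]/p h mul1r; have := mulr_ge0 ri0 (mulr_ge0 (p0 a (ac a v)) x2); lra.
  rewrite [p a (ac a v)]/p h mul1r; have := mulr_ge0 ri0 (mulr_ge0 (p0 a v) y2); lra.
rewrite -lerN2 opprK -sumrN.
apply: (@le_trans _ _ (\sum_(a : J) (r / 2 * (1 + 1) + (2 * r)^-1 *
    (\sum_(v <- L) p a v * d v ^+ 2 + \sum_(v <- K) p a v * c v ^+ 2)))).
  have uL : uniq L by rewrite filter_uniq// undup_uniq.
  have uK : uniq K by rewrite filter_uniq// undup_uniq.
  apply: ler_sum => a _; rewrite -sumrN.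
  apply: le_trans; first by apply: ler_sum => v _; exact: amgm.
  (* Reindexing by the injection [ac a]: an image of a member of [L] is nonempty, and if it is
     outside [K] the coefficient [c] vanishes there. *)
  have transfer (h : {fset I} -> R) : (forall v, 0 <= h v) ->
      (forall v, c v = 0 -> h v = 0) ->
      \sum_(v <- L) h (ac a v) <= \sum_(v <- K) h v.
    move=> h0 hc; rewrite -(big_map (ac a) xpredT h); apply: ler_sum_support => //.
      by rewrite map_inj_uniq.
    move=> v /mapP[v' v'L ->] vK; apply: hc; apply: coef_out; apply: contra vK => vs.
    by rewrite mem_filter vs andbT ac0; move: v'L; rewrite mem_filter => /andP[].
  have sub1 (l : seq {fset I}) (h : {fset I} -> R) : \sum_(u <- l) h u ^+ 2 <= 1 ->
      \sum_(u <- [seq v <- l | v != fset0]) h u ^+ 2 <= 1.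
    apply: le_trans; rewrite big_filter [leRHS](bigID (fun v => v != fset0))/= lerDl.
    by apply: sumr_ge0 => u _; exact: sqr_ge0.
  rewrite big_split /= -!mulr_sumr !big_split /=; apply: lerD; apply: ler_wpM2l.
  - by rewrite divr_ge0// ltW.
  - apply: lerD; last exact: sub1 (parseval tD).
    apply: le_trans (sub1 _ _ (parseval sC)); apply: (transfer (fun v => c v ^+ 2)).
      by move=> v; exact: sqr_ge0.
    by move=> v ->; rewrite expr0n.
  - by rewrite invr_ge0 mulr_ge0// ltW.
  rewrite lerD2l; apply: (transfer (fun v => p a v * c v ^+ 2)).
    by move=> v; rewrite mulr_ge0 ?ler0n ?sqr_ge0.
  by move=> v ->; rewrite expr0n/= mulr0.
(* With the sums exchanged, each nonempty [v] is counted for at most two dominant generators, and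
   Parseval bounds what remains. *)
have maj (l : seq {fset I}) (h : {fset I} -> R) : \sum_(u <- l) h u ^+ 2 <= 1 ->
    \sum_(a : J) \sum_(v <- [seq v <- l | v != fset0]) p a v * h v ^+ 2 <= 2.
  move=> l1; rewrite exchange_big /=.
  apply: (@le_trans _ _ (\sum_(u <- l) 2 * h u ^+ 2)); last first.
    by rewrite -mulr_sumr -[leRHS]mulr1 ler_wpM2l.
  rewrite big_filter [leRHS](bigID (fun v => v != fset0))/=.
  rewrite -[leLHS]addr0 lerD//; last by apply: sumr_ge0 => u _; rewrite mulr_ge0 ?sqr_ge0.
  apply: ler_sum => v v0; rewrite -mulr_suml ler_wpM2r ?sqr_ge0//.
  by rewrite -natr_sum (ler_nat _ _ 2) dominant_le2.
rewrite big_split /= sumJ -mulr_sumr big_split /=.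
have := maj _ _ (parseval sC); have := maj _ _ (parseval tD) => h1 h2.
(* The bound [maj] is used for [c] and for [d]; the total is [r * #|J|] plus [4 / (2 * r)], that is
   [2 / r]. *)
apply: (@le_trans _ _ (#|J|%:R * (r / 2 * (1 + 1)) + (2 * r)^-1 * (2 + 2))).
  rewrite lerD2l; apply: ler_wpM2l; last exact: lerD.
  by rewrite invr_ge0 mulr_ge0// ltW.
by rewrite le_eqVlt; apply/orP; left; apply/eqP; field; rewrite gt_eqF.
Qed.

End spectral_gap.

(** * The free part *)

Section long_words.
Context {S : finType}.
Implicit Types (a b : S) (w : seq S) (g : rword S).

Fixpoint alternating a b n : seq S :=
  if n is n'.+1 then a :: alternating b a n' else [::].

Lemma size_alternating a b n : size (alternating a b n) = n.
Proof. by elim: n a b => //= n IH a b; rewrite IH. Qed.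

Lemma path_alternating a b n : a != b ->
  path (fun s t => s != t) a (alternating b a n).
Proof. by elim: n a b => //= n IH a b ab; rewrite ab IH// eq_sym. Qed.

Lemma foldr_act w g : reduced (w ++ val g) -> val (foldr act g w) = w ++ val g.
Proof.
elim: w => //= s w IH swg.
rewrite IH; last exact: path_sorted swg.
by case: (w ++ val g) swg => //= t v /andP[st _]; rewrite eq_sym (negbTE st).
Qed.

(* A long word without cancellation against [w] is moved by [w]. *)
Lemma exists_moved_word w n : (1 < #|S|)%N -> reduced w -> w != [::] ->
  exists g, (n < size (val g))%N /\ foldr act g w <> g.
Proof.
move=> S2; case: w => // s w sw _.
have other (t : S) : exists t', t != t'.
  apply: contrapT => h; move: S2; rewrite ltnNge => /negP; apply.
  rewrite -(card1 t); apply: subset_leq_card; apply/fintype.subsetP => t' _; rewrite inE eq_sym.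
  by apply/negPn/negP => tt'; apply: h; exists t'.
(* As [a] differs from the last letter of the word, nothing cancels against an alternating word that
   starts with [a]. *)
have [a la] := other (last s w); have [b ab] := other a.
have rg : reduced (alternating a b n.+1) by exact: path_alternating.
pose g : rword S := exist (fun w => reduced w) _ rg.
exists g; split; first by rewrite /= size_alternating.
move=> /(congr1 (size \o val)) /=; rewrite -[LHS]/(size (val (foldr act g (s :: w)))).
rewrite foldr_act /= ?size_cat ?size_alternating; last first.
  by rewrite cat_path; apply/andP; split=> //=; rewrite la; exact: path_alternating.
by rewrite /= size_alternating; lia.
Qed.

End long_words.

Section free_part.
Context {R : realType} {S : finType}.
Local Notation I := (rword S).
Local Notation Y := (g_sigma_algebraType (@open (cube R I))).
Local Notation mu := (@coin R I).

Lemma coin_fin_num (A : set Y) : measurable A -> mu A \is a fin_num.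
Proof. exact: fin_num_measure. Qed.

Lemma fine_coin_le (A B : set Y) : measurable A -> measurable B -> A `<=` B ->
  fine (mu A) <= fine (mu B).
Proof.
move=> mA mB AB; apply: fine_le; rewrite ?coin_fin_num//.
by apply: le_measure => //; rewrite inE.
Qed.

Lemma fine_coin_leU (A B C : set Y) : measurable A -> measurable B -> measurable C ->
  A `<=` B `|` C -> fine (mu A) <= fine (mu B) + fine (mu C).
Proof.
move=> mA mB mC ABC; have mBC : measurable (B `|` C) by exact: measurableU.
apply: (le_trans (fine_coin_le mA mBC ABC)).
rewrite -fineD ?coin_fin_num//; apply: fine_le; rewrite ?fin_numD ?coin_fin_num//.
exact: measureU2.
Qed.

Lemma measurable_coin_setY (A B : set Y) : measurable A -> measurable B -> measurable (A `+` B).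
Proof. by move=> mA mB; apply: measurableU; exact: measurableD. Qed.

Lemma coin_real_approximation (B : set Y) (e : R) : measurable B -> 0 < e ->
  exists C, [/\ walsh_set C, measurable C, measurable (B `+` C) & fine (mu (B `+` C)) <= e].
Proof.
move=> mB e0; have [C wC BC] := coin_approximation mB e0.
have mC := walsh_set_measurable wC; have mBC := measurable_coin_setY mB mC.
by exists C; split=> //; rewrite -lee_fin fineK ?coin_fin_num.
Qed.

(** [foldr act g w] is the product [w g], so these are the fixed points of the shift by [w]. *)
Definition fixed_by (w : seq S) : set Y := [set x | forall g, x (foldr act g w) = x g].

Lemma measurable_coord_eq (g h : I) : measurable [set x : Y | x g = x h].
Proof.
rewrite (_ : mkset _ = ~` [set x : Y | parity (fsetY [fset g] [fset h])%fset x]).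
  by apply: measurableC; exact: measurable_parity.
apply/seteqP; split=> x /=; rewrite parityY !parity1; first by move=> ->; rewrite addbb.
by case: (x g); case: (x h) => //= h'; exfalso; apply: h'.
Qed.

Lemma measurable_fixed_by w : measurable (fixed_by w).
Proof. by apply: measurable_forallT => g; exact: measurable_coord_eq. Qed.

(** The indicator of [x g = x h] is half of one plus the Walsh function of [{g, h}]. As [g] occurs
    in no term of [s], that Walsh function pairs with none of them and only half of [mu C]
    survives. *)
Lemma coin_coord_eq s (C : set Y) (g h : I) : walsh_rep s C -> g != h ->
  (forall p, p \in s -> g \notin p.2) ->
  fine (mu (C `&` [set x : Y | x g = x h])) = fine (mu C) / 2.
Proof.
move=> sC gh gs; pose v := fsetY [fset g]%fset [fset h]%fset.
have tD : walsh_rep [:: (2^-1, fset0); (2^-1, v)] [set x : Y | x g = x h].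
  move=> x; rewrite /wpoly !big_cons big_nil /= walsh0 /walsh parityY !parity1 indicE.
  case: (eqVneq (x g) (x h)) => [xgh|/eqP xgh].
    by rewrite mem_set// xgh addbb /=; field.
  by rewrite memNset//; move: xgh; case: (x g); case: (x h) => //= _; ring.
have mE := walsh_rep_measure (walsh_repI sC tD).
rewrite big_mkcond big_allpairs_dep in mE.
rewrite [X in fine X]mE (walsh_rep_measure sC) /= [in RHS]big_mkcond mulr_suml big_seq [RHS]big_seq.
apply: eq_bigr => p ps; rewrite !big_cons big_nil /= !fsetY_eq0.
rewrite (_ : (p.2 == v) = false); first by case: ifP; rewrite ?mul0r !addr0.
apply/eqP => pv; move: (gs p ps); rewrite pv in_fsetY !inE eqxx (negbTE gh).
by [].
Qed.

(* If [C] approximates the fixed set, then intersecting [C] with [x g = x (w g)]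
   for a [g] outside the support of [C] halves its measure but loses almost none
   of the fixed set. *)
Lemma coin_fixed_by w : (1 < #|S|)%N -> reduced w -> w != [::] ->
  fine (mu (fixed_by w)) = 0.
Proof.
move=> S2 rw w0; apply/eqP; rewrite eq_le fine_ge0 ?measure_ge0// andbT.
apply/ler_addgt0Pl => e e0; rewrite addr0.
(* Let [Z] be the fixed set, with measures of sets denoted by the sets, and let [d] be the measure
   of the difference. Then [Z <= C / 2 + d] and [C <= Z + d] yield [Z <= 3 d], whence [e / 3]. *)
have mZ := measurable_fixed_by w; have e30 : 0 < e / 3 by rewrite divr_gt0.
have [C [[s sC] mC mZC ZCe]] := coin_real_approximation mZ e30.
(* A word longer than [N] occurs in no term of the expansion of [C]. *)
pose N := (\max_(p <- s) \max_(k <- p.2) size (val k))%N.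
have [g [gN gh]] := exists_moved_word N S2 rw w0.
have mD := measurable_coord_eq g (foldr act g w).
have gs p : p \in s -> g \notin p.2.
  move=> ps; apply/negP => gp; move: gN; rewrite ltnNge => /negP; apply.
  apply: (@leq_trans (\max_(k <- p.2) size (val k))%N); last exact: leq_bigmax_seq.
  exact: leq_bigmax_seq.
have gh' : g != foldr act g w by apply/eqP => /esym.
have CD := coin_coord_eq sC gh' gs.
have ZCD : fine (mu (fixed_by w)) <=
    fine (mu (C `&` [set x : Y | x g = x (foldr act g w)])) + fine (mu (fixed_by w `+` C)).
  apply: fine_coin_leU => //; first exact: measurableI.
  move=> x Zx; have [Cx|Cx] := pselect (C x); first by left; split=> //=; rewrite Zx.
  by right; left.
have CZ : fine (mu C) <= fine (mu (fixed_by w)) + fine (mu (fixed_by w `+` C)).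
  apply: fine_coin_leU => // x Cx; have [Zx|Zx] := pselect (fixed_by w x); first by left.
  by right; right.
move: ZCD CZ; rewrite CD; lra.
Qed.

Definition free_part : set Y :=
  [set x | forall w, reduced w && (w != [::]) -> ~ fixed_by w x].

Lemma measurable_free_part : measurable free_part.
Proof.
apply: measurable_forallT => w; case: (reduced w && (w != [::])).
  rewrite [X in measurable X](_ : _ = ~` fixed_by w).
    by apply: measurableC; exact: measurable_fixed_by.
  by apply/seteqP; split=> x /=; [apply|].
by rewrite [X in measurable X](_ : _ = setT)//; apply/seteqP; split.
Qed.

(** The complement of the free part is a countable union, over nontrivial reduced words, of null
    fixed sets. *)
Lemma coin_free_part (B : set Y) : (1 < #|S|)%N -> measurable B ->
  fine (mu (B `&` free_part)) = fine (mu B).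
Proof.
move=> S2 mB; have mF := measurable_free_part.
have mBF : measurable (B `&` free_part) by exact: measurableI.
apply/eqP; rewrite eq_le (fine_coin_le mBF mB (@subIsetl _ _ _)) /=.
suff F0 : mu (~` free_part) = 0%E.
  rewrite -[leRHS]addr0 -[X in _ + X]/(fine 0%E) -F0.
  apply: fine_coin_leU => //; first exact: measurableC.
  by move=> x Bx; have [Fx|Fx] := pselect (free_part x); [left|right].
pose Z n : set Y := if choice.unpickle n is Some w then
  if reduced w && (w != [::]) then fixed_by w else set0 else set0.
suff : mu.-negligible (~` free_part) by move/negligibleP => -> //; exact: measurableC.
apply: (@negligibleS _ _ _ _ (\bigcup_n Z n)).
  move=> x /= /existsNP[w /not_implyP[rw /contrapT wx]]; exists (choice.pickle w) => //.
  by rewrite /Z choice.pickleK rw.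
apply: negligible_bigcup => n; rewrite /Z; case: choice.unpickle => [w|]; last exact: negligible_set0.
case: ifP => [/andP[rw w0]|_]; last exact: negligible_set0.
apply/negligibleP; first exact: measurable_fixed_by.
by rewrite -[LHS]fineK ?coin_fin_num ?coin_fixed_by//; exact: measurable_fixed_by.
Qed.

End free_part.

(** * The shift graphs *)

Section expansion.
Context {R : realType} {S : finType}.
Local Notation I := (rword S).
Local Notation Y := (g_sigma_algebraType (@open (cube R I))).
Local Notation mu := (@coin R I).

Lemma coin_expansion (J : finType) (e : J -> S) (n : nat) (B B' : set Y) :
  injective e -> (0 < n)%N -> #|J| = (32 * n ^ 4)%N ->
  measurable B -> measurable B' ->
  n%:R^-1 <= fine (mu B) -> n%:R^-1 <= fine (mu B') ->
  exists a x, B x /\ B' (pullback (act (e a)) x).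
Proof.
move=> eI n0 cJ mB mB' nB nB'; apply: contrapT => nBB'.
set y : R := n%:R^-1 in nB nB' *.
have y0 : 0 < y by rewrite invr_gt0 ltr0n.
have y1 : y <= 1 by rewrite invf_le1 ?ltr0n// ler1n.
have JE : #|J|%:R = 32 / y ^+ 4 :> R by rewrite cJ natrM natrX /y exprVn invrK.
(* Two errors of this size bound each correlation of [C] and [D] by [y ^+ 2 / 8], while both
   measures stay close to [y]. *)
have e0 : 0 < y ^+ 2 / 16 by rewrite divr_gt0// exprn_gt0.
have [C [[s sC] mC mBC BCe]] := coin_real_approximation mB e0.
have [D [[t tD] mD mBD BDe]] := coin_real_approximation mB' e0.
(* This [r] balances the two error terms of the spectral gap: [r * #|J|] and [2 / r] both equal
   [8 / y ^+ 2]. *)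
have r0 : 0 < y ^+ 2 / 4 by rewrite divr_gt0// exprn_gt0.
have := spectral_gap eI r0 sC tD.
(* No point of [B] is sent into [B'], so a point counted here lies in the error set of [C] or is
   sent into that of [D]; the shift preserves the measure of the latter. *)
have small a : fine (mu (C `&` pullback (act (e a)) @^-1` D)) <= y ^+ 2 / 8.
  have mp (A : set Y) : measurable A -> measurable (pullback (act (e a)) @^-1` A).
    by move=> mA; rewrite -[X in measurable X]setTI; exact: measurable_pullback.
  apply: (@le_trans _ _ (fine (mu (B `+` C)) +
      fine (mu (pullback (act (e a)) @^-1` (B' `+` D))))).
    apply: fine_coin_leU => //; [by apply: measurableI => //; exact: mp|exact: mp|].
    move=> x [Cx Dx]; have [Bx|Bx] := pselect (B x); last by left; right.
    by right; right; split=> // B'x; apply: nBB'; exists a, x.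
  rewrite [X in _ + fine X]coin_pullback//; last exact: act_inj.
  lra.
have := ler_sum (index_enum J) (P := xpredT) (fun a _ => small a).
rewrite sumr_const -[X in _ <= X -> _]mulr_natl => up low.
have := le_trans low up; rewrite JE => {low up}.
have BC : y - y ^+ 2 / 16 <= fine (mu C).
  rewrite lerBlDr; apply: (le_trans nB); apply: le_trans (lerD (lexx _) BCe).
  apply: fine_coin_leU => // x Bx; have [Cx|Cx] := pselect (C x); first by left.
  by right; left.
have BD : y - y ^+ 2 / 16 <= fine (mu D).
  rewrite lerBlDr; apply: (le_trans nB'); apply: le_trans (lerD (lexx _) BDe).
  apply: fine_coin_leU => // x Bx; have [Dx|Dx] := pselect (D x); first by left.
  by right; left.
have ye : 0 <= y - y ^+ 2 / 16 by nra.
(* The square of [y - y ^+ 2 / 16] is at least [y ^+ 2 - y ^+ 3 / 8], and [y <= 1]. *)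
have CD : 7 / 8 * y ^+ 2 <= fine (mu C) * fine (mu D).
  apply: le_trans (ler_pM ye ye BC BD); nra.
have := ler_wpM2l (ltW (_ : 0 < 32 / y ^+ 4)) CD.
move=> /(_ (ltac:(by rewrite divr_gt0// exprn_gt0))) h1 h2.
have : 32 / y ^+ 4 * (7 / 8 * y ^+ 2) - (y ^+ 2 / 4 * (32 / y ^+ 4) + 2 / (y ^+ 2 / 4))
    <= 32 / y ^+ 4 * (y ^+ 2 / 8) by apply: le_trans h2; rewrite lerD2r.
(* In units of [1 / y ^+ 2] the inequality reads [28 - (8 + 8) <= 4], which is absurd. *)
have -> : 32 / y ^+ 4 * (7 / 8 * y ^+ 2) = 28 / y ^+ 2 by field; rewrite gt_eqF.
have -> : y ^+ 2 / 4 * (32 / y ^+ 4) = 8 / y ^+ 2 by field; rewrite gt_eqF.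
have -> : 2 / (y ^+ 2 / 4) = 8 / y ^+ 2 by field; rewrite gt_eqF.
have -> : 32 / y ^+ 4 * (y ^+ 2 / 8) = 4 / y ^+ 2 by field; rewrite gt_eqF.
have : 0 < (y ^+ 2)^-1 by rewrite invr_gt0 exprn_gt0.
lra.
Qed.

End expansion.

(** * Borel structure, acyclicity and degree of the shift graphs *)

Section shift_graph.
Context {R : realType} {S : finType}.
Local Notation I := (rword S).
Local Notation Y := (g_sigma_algebraType (@open (cube R I))).
Local Notation mu := (@coin R I).
Implicit Types (x y : Y) (P : pred S).

Definition shift (x : Y) (s : S) : Y := pullback (act s) x.

Definition shift_graph P : set (Y * Y) := [set p |
  [/\ free_part p.1, free_part p.2 & exists2 s, P s & p.2 = shift p.1 s]].

Lemma shiftK s : involutive (shift^~ s).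
Proof. by move=> x; apply/funext => g; rewrite /shift /pullback /= actK. Qed.

Lemma foldl_shift x (l : seq S) g : foldl shift x l g = x (foldr act g l).
Proof. by elim: l x => //= s l IH x; rewrite IH. Qed.

(** Otherwise the reduced word [[:: s; t]] would fix [x]. Hence an edge determines its generator,
    which makes graphs with disjoint label sets disjoint. *)
Lemma free_shift x s t : free_part x -> shift x s = shift x t -> s = t.
Proof.
move=> fx st; apply/eqP/negPn/negP => neq; apply: (fx [:: s; t]).
  by rewrite /reduced /= neq.
move=> g; rewrite -(foldl_shift x [:: s; t]) /= st; exact: (congr1 (fun z : Y => z g) (shiftK t x)).
Qed.

Lemma simple_shift_graph P : simple_graph (shift_graph P).
Proof.
split=> [x [/= fx _ [s _ xs]]|x y [/= fx fy [s Ps ys]]].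
  by apply: (fx [:: s]) => // g; rewrite -(foldl_shift x [:: s]) /= -xs.
by split=> //=; exists s => //; rewrite ys shiftK.
Qed.

(** Being a shift of [p.1] by a fixed generator is a conjunction of countably many equalities
    between coordinates. *)
Lemma measurable_shift_graph P : measurable (shift_graph P).
Proof.
have mp1 (A : set Y) : measurable A -> measurable [set p : Y * Y | A p.1].
  by move=> mA; rewrite -[X in measurable X]setTI; exact: measurable_fst.
have mp2 (A : set Y) : measurable A -> measurable [set p : Y * Y | A p.2].
  by move=> mA; rewrite -[X in measurable X]setTI; exact: measurable_snd.
rewrite (_ : shift_graph P = ([set p : Y * Y | free_part p.1] `&` [set p : Y * Y | free_part p.2]) `&`
    [set p : Y * Y | exists s : S, P s /\ forall g, p.2 g = p.1 (act s g)]); last first.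
  apply/seteqP; split=> -[x y] /=.
    by move=> [/= fx fy [s Ps xy]]; split=> //; exists s; split=> // g; rewrite xy.
  by move=> [[fx fy] [s [Ps xy]]]; split=> //; exists s => //; apply/funext.
apply: measurableI; first by apply: measurableI; [apply: mp1|apply: mp2]; exact: measurable_free_part.
apply: measurable_existsT => s; case: (P s); last first.
  by rewrite [X in measurable X](_ : _ = set0)//; apply/seteqP; split=> p // -[].
rewrite [X in measurable X](_ : _ = [set p : Y * Y | forall g, p.2 g = p.1 (act s g)]); last first.
  by apply/seteqP; split=> p // -[].
apply: measurable_forallT => g.
have m1 := mp1 _ (measurable_coord (R := R) (act s g)).
have m2 := mp2 _ (measurable_coord (R := R) g).
rewrite [X in measurable X](_ : _ =
  ([set p : Y * Y | p.1 (act s g)] `&` [set p : Y * Y | p.2 g]) `|`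
  (~` [set p : Y * Y | p.1 (act s g)] `&` ~` [set p : Y * Y | p.2 g])).
  by apply: measurableU; apply: measurableI => //; exact: measurableC.
apply/seteqP; split=> p /=.
  by move=> ->; case: (p.1 _) => /=; [left|right].
by case: (p.1 _); case: (p.2 _) => //= -[[]|[]] //.
Qed.

Lemma shift_graph_disjoint P Q : (forall s, P s -> ~~ Q s) ->
  shift_graph P `&` shift_graph Q = set0.
Proof.
move=> PQ; apply/seteqP; split=> // -[x y] /= [[/= fx _ [s Ps ->]] [/= _ _ [t Qt]]].
by move=> /(free_shift fx) st; move: (PQ _ Ps); rewrite st Qt.
Qed.

Lemma shift_graph_path P x (q : seq Y) : path [rel x y | (x, y) \in shift_graph P] x q ->
  exists l, q = scanl shift x l.
Proof.
elim: q x => [|y q IH] x /=; first by exists [::].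
case/andP => /set_mem[/= _ _ [s _ ->]] /IH[l ->].
by exists (s :: l).
Qed.

(** The labels along a cycle spell a nonempty word fixing [x]. Two equal consecutive letters would
    mean backtracking and repeat a vertex, so the word is reduced, against freeness. *)
Lemma acyclic_shift_graph P : acyclic (shift_graph P).
Proof.
move=> [//|x p] p2 /andP[cyc unq].
have fx : free_part x.
  by move: cyc; case: p {p2 unq} => [|y p] /= /andP[/set_mem[]].
have [l pl] := shift_graph_path cyc.
have szl : size l = (size p).+1 by rewrite -(size_scanl shift x l) -pl size_rcons.
pose z i := foldl shift x (take i l).
have zp i : (i <= size p)%N -> z i = nth x (x :: p) i.
  case: i => [|i] ip; first by rewrite /z take0.
  rewrite /z -(nth_scanl x) ?szl 1?ltnS 1?ltnW// -pl /= nth_rcons ip//.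
have zl : z (size p).+1 = x.
  by rewrite /z -(nth_scanl x) ?szl// -pl nth_rcons ltnn eqxx.
have zS i s : (i < size l)%N -> z i.+1 = shift (z i) (nth s l i).
  by move=> il; rewrite /z (take_nth s)// -cats1 foldl_cat.
case: l szl @z zp zl zS {pl} => // s0 l' szl z zp zl zS; set l := s0 :: l' in szl z zp zl zS.
apply: (fx l); last first.
  by move=> g; rewrite -foldl_shift -[in RHS]zl /z take_oversize// szl.
rewrite andbT; apply/(sortedP s0) => i il; apply/eqP => si.
have zi : z i.+2 = z i.
  by rewrite (zS _ s0)// (zS _ s0) ?(ltnW il)// -si shiftK.
(* If step [i.+2] closes the cycle, vertex [i] is the initial one, though length at least 3 forces
   [i > 0]. Otherwise vertices [i] and [i.+2] of the list coincide. *)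
have := il; rewrite szl ltnS leq_eqVlt => /orP[/eqP ip|ip].
  move: zi; rewrite ip zl zp -?ip// => /eqP; rewrite -{1}[x]/(nth x (x :: p) 0).
  rewrite nth_uniq//=; last by rewrite -ip ltnS leqnSn.
  by move: p2 => /=; rewrite -ip; case: i {il si ip}.
move: zi; rewrite !zp// => [|]; last by rewrite ltnW// ltnW.
move/eqP; rewrite nth_uniq//=; last by rewrite ltnS ltnW// ltnW.
by move/eqP; lia.
Qed.

Lemma bounded_degree_shift_graph P : bounded_degree (shift_graph P).
Proof.
exists #|S| => x.
apply: (card_le_trans (B := range (shift x))).
  by apply: subset_card_le => y [/= _ _ [s _ ->]]; exists s.
apply: (card_le_trans (card_image_le _ _)).
pose f (s : S) : nat := enum_rank s.
rewrite (_ : setT = f @^-1` `I_#|S|); last by apply/seteqP; split=> s //= _; exact: ltn_ord.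
by apply: card_ge_preimage => s t _ _ /val_inj/enum_rank_inj.
Qed.

End shift_graph.

Theorem theorem3p3 (R : realType) (k n : nat) (hk : (1 <= k)%N)
    (hn : (3 <= n)%N) :
  exists (d : measure_display) (Y : measurableType d) (mu : probability Y R)
         (G : 'I_k -> set (Y * Y)),
    [/\ standard_borel R Y,
        forall j, borel_graph (G j),
        forall i j, i != j -> G i `&` G j = set0,
        acyclic (\bigcup_j G j) /\ bounded_degree (\bigcup_j G j) &
        forall (j : 'I_k) (B B' : set Y),
          measurable B -> measurable B' ->
          ((n%:R^-1)%:E <= mu B)%E -> ((n%:R^-1)%:E <= mu B')%E ->
          exists z z', [/\ B z, B' z' & G j (z, z')]].
Proof.
(* Letter [(j, a)] has colour [j]; each colour class has the [m] letters that [coin_expansion] asks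
   for. *)
pose m := (32 * n ^ 4)%N; pose S : finType := ('I_k * 'I_m)%type.
pose Y := g_sigma_algebraType (@open (cube R (rword S))).
pose P (j : 'I_k) : pred S := fun s => s.1 == j.
have n0 : (0 < n)%N by exact: leq_trans hn.
have S2 : (1 < #|S|)%N.
  rewrite card_prod !card_ord; apply: leq_trans (leq_mul hk (leqnn m)); rewrite mul1n.
  by rewrite /m (leq_trans _ (leq_mul (leqnn 32) (_ : 0 < n ^ 4)%N))// expn_gt0 n0.
exists _, Y, (@coin R (rword S)), (fun j => shift_graph (P j)).
have U : \bigcup_j shift_graph (P j) = shift_graph xpredT :> set (Y * Y).
  apply/seteqP; split=> -[x y] /=; first by move=> [j _ [/= fx fy [s _ ys]]]; split=> //; exists s.
  by move=> [/= fx fy [s _ ys]]; exists s.1 => //; split=> //; exists s => //; exact: eqxx.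
split.
- exists (cube R (rword S)), id; split; [exact: cube_complete|exact: cube_separable|by exists id|].
  by [].
- by move=> j; split; [exact: simple_shift_graph|exact: measurable_shift_graph].
- move=> i j ij; apply: shift_graph_disjoint => s /eqP si; rewrite /P si; exact: ij.
- by rewrite U; split; [exact: acyclic_shift_graph|exact: bounded_degree_shift_graph].
move=> j B B' mB mB' nB nB'.
have mF := @measurable_free_part R S.
(* Cutting [B] and [B'] down to the free part keeps their measures and ensures that the pair found
   is an edge. *)
have big A : measurable A -> ((n%:R^-1)%:E <= @coin R (rword S) A)%E ->
    n%:R^-1 <= fine (@coin R (rword S) (A `&` free_part)).
  by move=> mA nA; rewrite coin_free_part// -lee_fin fineK ?coin_fin_num.
have eI : injective (fun a : 'I_m => (j, a) : S) by move=> a b [].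
have [a [x [[Bx fx] [B'x fx']]]] := coin_expansion eI n0 (card_ord m)
  (measurableI _ _ mB mF) (measurableI _ _ mB' mF) (big _ mB nB) (big _ mB' nB').
exists x, (shift x (j, a)); split=> //; split=> //; exists (j, a) => //; exact: eqxx.
Qed.
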